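(* Let $\Bbbk$ be an algebraically closed field with $\operatorname{char}\Bbbk\neq2$, let $X$ be a projective scheme over $\Bbbk$ and $L$ a very ample line bundle on $X$ with a decomposition $L=L_1^{\otimes2}\otimes L_2$, where $L_1,L_2$ are line bundles on $X$ with $p:=h^0(X,L_1)\ge2$ and $q:=h^0(X,L_2)\ge1$. Then the subspace $W_{L_1,L_2}\subseteq I(X)_2$ is spanned by $\Gamma(L_1,L_2)$ as a $\Bbbk$-vector space.
   Context: The linearly normal embedding $X\subset\mathbb{P}H^0(X,L)=\mathbb{P}^r$ induces an isomorphism $f:H^0(X,L)\to H^0(\mathbb{P}^r,\mathcal{O}_{\mathbb{P}^r}(1))$. $I(X)$ is the homogeneous ideal of $X$ in $\mathbb{P}^r$. Define $Q=Q_{L_1,L_2}:H^0(X,L_1)\times H^0(X,L_1)\times H^0(X,L_2)\to I(X)_2$ by $$Q(s,t,h)=f(s\otimes s\otimes h)f(t\otimes t\otimes h)-f(s\otimes t\otimes h)^2.$$ $W_{L_1,L_2}$ is the $\Bbbk$-subspace of $I(X)_2$ spanned by the image of $Q_{L_1,L_2}$. Let $\{s_1,\dots,s_p\}$ and $\{h_1,\dots,h_q\}$ be any chosen bases of $H^0(X,L_1)$ and $H^0(X,L_2)$. Put $\Delta_1=\{(i,j): 1\le i<j\le p\}$; $\Delta_2=\{(i,j,k): (i,j)\in\Delta_1,\ 1\le k\le p,\ k\ne i,j\}$; $\Delta_3=\{(i,j,k,l): (i,j),(k,l)\in\Delta_1,\ i<k,\ j\neq k,l\}$; $H=\{h_1,\dots,h_q\}\cup\{h_i+h_j: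 1\le i<j\le q\}$. Then $\Gamma(L_1,L_2)=\Gamma_{11}\cup\Gamma_{12}\cup\Gamma_{22}$, where $\Gamma_{11}=\{Q(s_i,s_j,h):(i,j)\in\Delta_1,h\in H\}$, $\Gamma_{12}=\{Q(s_i+s_j,s_k,h):(i,j,k)\in\Delta_2,h\in H\}$, $\Gamma_{22}=\{Q(s_i+s_j,s_k+s_l,h):(i,j,k,l)\in\Delta_3,h\in H\}$. *)

(* Defs.v *)
From HB Require Import structures.
From mathcomp Require Import all_boot all_order all_algebra.
From mathcomp Require Import boolp classical_sets topology_structure.
From mathcomp Require Import mpoly.

Set Implicit Arguments.
Unset Strict Implicit.
Unset Printing Implicit Defensive.

Import GRing.Theory.
Local Open Scope classical_set_scope.
Local Open Scope ring_scope.

Record opens (T : topologicalType) := Opens { oset :> set T; _ : open oset }.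

Definition whole (T : topologicalType) : opens T := Opens (@openT T).

Fact sub_whole (T : topologicalType) (U : opens T) : U `<=` whole T.
Proof. by []. Qed.

Definition is_sheaf (T : topologicalType) (F : opens T -> Type)
    (res : forall U V : opens T, V `<=` U -> F U -> F V) : Prop :=
  [/\ forall (U : opens T) (UU : U `<=` U) (s : F U), res U U UU s = s,
      forall (U V W : opens T) (VU : V `<=` U) (WV : W `<=` V) (WU : W `<=` U)
        (s : F U), res V W WV (res U V VU s) = res U W WU s
    & forall (I : Type) (U : opens T) (V : I -> opens T)
        (VU : forall i, V i `<=` U),
        (forall x, oset U x -> exists i, oset (V i) x) ->
      forall s : (forall i, F (V i)),
        (forall i j (W : opens T) (Wi : W `<=` V i) (Wj : W `<=` V j),
            res (V i) W Wi (s i) = res (V j) W Wj (s j)) ->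
        exists! t : F U, forall i, res U (V i) (VU i) t = s i].

(* The structure morphism to Spec k is given by the ring morphism [kmap].
   The rings of sections are [comPzRingType]s since O(set0) is the zero ring. *)
Record ringedSpace (k : fieldType) := RingedSpace {
  pts :> topologicalType;
  O : opens pts -> comPzRingType;
  ores : forall U V : opens pts, V `<=` U -> {rmorphism O U -> O V};
  ores_sheaf : @is_sheaf pts O (fun U V VU => @ores U V VU);
  kmap : {rmorphism k -> O (whole pts)} }.

Definition kres (k : fieldType) (X : ringedSpace k) (U : opens X) (c : k) :
  O U := ores (@sub_whole _ U) (kmap X c).

Definition unit_near (k : fieldType) (X : ringedSpace k) (U : opens X)
    (f : O U) (x : X) : Prop :=
  exists (V : opens X) (VU : V `<=` U),
    oset V x /\ exists g : O V, ores VU f * g = 1.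

Record prime_ideal (A : comPzRingType) (P : set A) : Prop := {
  prime_0 : P 0;
  prime_lin : forall a u v, P u -> P v -> P (a * u + v);
  prime_1 : ~ P 1;
  prime_mul : forall u v, P (u * v) -> P u \/ P v }.

Definition is_localization (A B : comPzRingType) (theta : A -> B) (f : A) :=
  [/\ exists g, theta f * g = 1,
      forall a, theta a = 0 -> exists n, f ^+ n * a = 0
    & forall b, exists n a, b * theta (f ^+ n) = theta a].

(* (U, O|U) is isomorphic to Spec O(U): sending a point to the ideal of the
   functions that vanish there is a homeomorphism from U onto the prime
   spectrum, and O(D(f)) is the localization O(U)_f for each f in O(U). *)
Definition affine (k : fieldType) (X : ringedSpace k) (U : opens X) : Prop :=
  [/\ forall x, oset U x -> prime_ideal [set f : O U | ~ unit_near f x],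
      forall P : set (O U), prime_ideal P ->
        exists! x, oset U x /\ P = [set f : O U | ~ unit_near f x],
      forall (V : opens X) x, V `<=` U -> oset V x ->
        exists f : O U, unit_near f x /\ [set y | unit_near f y] `<=` V
    & forall (f : O U) (V : opens X) (VU : V `<=` U),
        oset V = [set y | unit_near f y] -> is_localization (ores VU) f].

Record scheme (k : fieldType) := Scheme {
  space :> ringedSpace k;
  locally_affine : forall x : space, exists2 U : opens space, oset U x & affine U }.

Record omodule (k : fieldType) (X : ringedSpace k) := OModule {
  sec :> forall U : opens X, lmodType (O U);
  mres : forall U V : opens X, V `<=` U -> sec U -> sec V;
  mres_lin : forall (U V : opens X) (VU : V `<=` U) a (s t : sec U),
    mres VU (a *: s + t) = ores VU a *: mres VU s + mres VU t;
  mres_sheaf : @is_sheaf X sec mres }.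

Definition is_frame (k : fieldType) (X : ringedSpace k) (F : omodule X)
    (U : opens X) (e : F U) : Prop :=
  forall (V : opens X) (VU : V `<=` U),
    bijective (fun a : O V => a *: mres VU e).

Record line_bundle (k : fieldType) (X : ringedSpace k) := LineBundle {
  bundle :> omodule X;
  locally_trivial : forall x : X,
    exists2 U : opens X, oset U x & exists e : bundle U, is_frame e }.

Record omod_hom (k : fieldType) (X : ringedSpace k) (F G : omodule X) :=
  OmodHom {
  hom_fun :> forall U : opens X, F U -> G U;
  hom_lin : forall (U : opens X) a (s t : F U),
    hom_fun (a *: s + t) = a *: hom_fun s + hom_fun t;
  hom_nat : forall (U V : opens X) (VU : V `<=` U) (s : F U),
    mres VU (hom_fun s) = hom_fun (mres VU s) }.

Record omod_bilin (k : fieldType) (X : ringedSpace k) (F G N : omodule X) :=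
  OmodBilin {
  bil_fun :> forall U : opens X, F U -> G U -> N U;
  bil_linl : forall (U : opens X) a (s s' : F U) (t : G U),
    bil_fun (a *: s + s') t = a *: bil_fun s t + bil_fun s' t;
  bil_linr : forall (U : opens X) a (s : F U) (t t' : G U),
    bil_fun s (a *: t + t') = a *: bil_fun s t + bil_fun s t';
  bil_nat : forall (U V : opens X) (VU : V `<=` U) (s : F U) (t : G U),
    mres VU (bil_fun s t) = bil_fun (mres VU s) (mres VU t) }.

Definition is_tensor (k : fieldType) (X : ringedSpace k) (F G N : omodule X)
    (tau : omod_bilin F G N) : Prop :=
  forall (P : omodule X) (beta : omod_bilin F G P),
  exists gamma : omod_hom N P,
    (forall (U : opens X) (s : F U) (t : G U),
        gamma U (tau U s t) = beta U s t) /\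
    (forall gamma' : omod_hom N P,
        (forall (U : opens X) (s : F U) (t : G U),
            gamma' U (tau U s t) = beta U s t) ->
        forall (U : opens X) (n : N U), gamma' U n = gamma U n).

Definition H0 (k : fieldType) (X : ringedSpace k) (F : omodule X) : Type :=
  F (whole X).

HB.instance Definition _ (k : fieldType) (X : ringedSpace k) (F : omodule X) :=
  GRing.Zmodule.on (H0 F).

Section H0Lmodule.
Variables (k : fieldType) (X : ringedSpace k) (F : omodule X).

Definition H0_scale (c : k) (s : H0 F) : H0 F :=
  kmap X c *: (s : F (whole X)).

Fact H0_scaleA a b s : H0_scale a (H0_scale b s) = H0_scale (a * b) s.
Proof. by rewrite /H0_scale scalerA rmorphM. Qed.

Fact H0_scale1 : left_id 1 H0_scale.
Proof. by move=> s; rewrite /H0_scale rmorph1 scale1r. Qed.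

Fact H0_scaleDr : right_distributive H0_scale +%R.
Proof. by move=> a s t; rewrite /H0_scale scalerDr. Qed.

Fact H0_scaleDl s : {morph H0_scale^~ s : a b / a + b}.
Proof. by move=> a b; rewrite /H0_scale rmorphD scalerDl. Qed.

HB.instance Definition _ := GRing.Zmodule_isLmodule.Build k (H0 F)
  H0_scaleA H0_scale1 H0_scaleDr H0_scaleDl.

End H0Lmodule.

Definition restrict (k : fieldType) (X : ringedSpace k) (F : omodule X)
  (U : opens X) (s : H0 F) : F U := mres (@sub_whole _ U) s.

Definition is_basis (k : fieldType) (V : lmodType k) (n : nat) (b : 'I_n -> V) :=
  forall v : V, exists! c : 'rV[k]_n, v = \sum_i c 0 i *: b i.

Definition lin_span (k : fieldType) (V : lmodType k) (A : set V) : set V :=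
  [set v | exists (n : nat) (c : 'I_n -> k) (w : 'I_n -> V),
     (forall i, A (w i)) /\ v = \sum_i c i *: w i].

(* The underlying space of P^n = Proj k[X_0, ..., X_n]. *)
Record proj_space (k : fieldType) (n : nat) := ProjPoint {
  pideal : set {mpoly k[n.+1]};
  pideal_prime : prime_ideal pideal;
  pideal_homog : forall F, pideal F -> forall d, pideal (pihomog mdeg d F);
  pideal_relevant : exists i, ~ pideal 'X_i }.

HB.instance Definition _ (k : fieldType) (n : nat) :=
  gen_eqMixin (proj_space k n).
HB.instance Definition _ (k : fieldType) (n : nat) :=
  gen_choiceMixin (proj_space k n).

Section ZariskiTopology.
Variables (k : fieldType) (n : nat).

Definition zariski_open (W : set (proj_space k n)) : Prop :=
  exists S : set {mpoly k[n.+1]}, W = [set P | ~ S `<=` pideal P].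

Fact zariski_openT : zariski_open setT.
Proof.
exists [set 1]; apply/seteqP; split=> // P _ /= h.
exact: (prime_1 (pideal_prime P)) (h 1 erefl).
Qed.

Fact zariski_openI : setI_closed zariski_open.
Proof.
move=> _ _ [S ->] [T ->].
exists [set F | exists2 G, S G & exists2 H, T H & F = G * H].
apply/seteqP; split=> P /=.
  move=> [hS hT] h.
  have [G SG nG] : exists2 G, S G & ~ pideal P G.
    by apply: contrapT => no; apply: hS => G SG; apply: contrapT => nG;
       apply: no; exists G.
  have [H TH nH] : exists2 H, T H & ~ pideal P H.
    by apply: contrapT => no; apply: hT => H TH; apply: contrapT => nH;
       apply: no; exists H.
  have : pideal P (G * H) by apply: h; exists G => //; exists H.
  by case/(prime_mul (pideal_prime P)).
have pM G H : pideal P H -> pideal P (G * H).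
  move=> PH; have [P0 Pl _ _] := pideal_prime P.
  by rewrite -[_ * _]addr0; apply: Pl.
move=> h; split=> h'; apply: h => _ [G SG [H TH ->]].
  by rewrite mulrC; apply/pM/h'.
by apply/pM/h'.
Qed.

Fact zariski_open_bigU (I : Type) (W : I -> set (proj_space k n)) :
  (forall i, zariski_open (W i)) -> zariski_open (\bigcup_i W i).
Proof.
move=> oW; have [S eS] := choice oW.
exists (\bigcup_i S i); apply/seteqP; split=> P /=.
  by move=> [i _]; rewrite eS /= => hi h; apply: hi => F SF; apply: h; exists i.
move=> h; apply: contrapT => no; apply: h => F [i _ SF].
apply: contrapT => nF; apply: no; exists i => //.
by rewrite eS /= => h; apply/nF/h.
Qed.

HB.instance Definition _ := isOpenTopological.Build (proj_space k n)
  zariski_openT zariski_openI zariski_open_bigU.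

End ZariskiTopology.

(* The value F(a) for a polynomial F over k and functions a_i in O(U);
   [mmap] is not available here since O(U) can be the zero ring. *)
Definition peval (k : fieldType) (X : ringedSpace k) (U : opens X) (n : nat)
    (a : 'I_n -> O U) (F : {mpoly k[n]}) : O U :=
  \sum_(m <- msupp F) kres U F@_m * \prod_(i < n) a i ^+ m i.

(* The sections y_i are a_i e over U, for a frame e of L over U; a form F of
   degree d in the y_i is then F(a) e^d. *)
Definition local_coords (k : fieldType) (X : ringedSpace k) (L : omodule X)
    (n : nat) (y : 'I_n -> H0 L) (U : opens X) (a : 'I_n -> O U) : Prop :=
  exists2 e : L U, is_frame e & forall i, restrict U (y i) = a i *: e.

Definition form_nonzero_at (k : fieldType) (X : ringedSpace k) (L : omodule X)
    (n : nat) (y : 'I_n -> H0 L) (F : {mpoly k[n]}) (x : X) : Prop :=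
  exists (U : opens X) (a : 'I_n -> O U),
    [/\ oset U x, local_coords y a & exists g, peval a F * g = 1].

Definition locally_closed (T : topologicalType) (A : set T) : Prop :=
  exists B C : set T, [/\ open B, closed C & A = B `&` C].

(* phi is the map of spaces underlying the morphism
   x |-> (y_0(x) : ... : y_n(x)) from X to P^n; in particular, such a phi
   exists only if the y_i have no common zero. *)
Definition is_proj_map (k : fieldType) (X : ringedSpace k) (L : omodule X)
    (n : nat) (y : 'I_n.+1 -> H0 L) (phi : X -> proj_space k n) : Prop :=
  forall (x : X) (d : nat) (F : {mpoly k[n.+1]}), F \is d.-homog ->
    (pideal (phi x) F <-> ~ form_nonzero_at y F x).

(* Surjectivity of O_(P^n, phi x) -> O_(X, x): each germ of function on X is a
   quotient of two forms of the same degree in the y_i. *)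
Definition stalk_surjective (k : fieldType) (X : ringedSpace k) (L : omodule X)
    (n : nat) (y : 'I_n.+1 -> H0 L) : Prop :=
  forall (x : X) (U : opens X) (g : O U), oset U x ->
  exists (V : opens X) (VU : V `<=` U) (a : 'I_n.+1 -> O V) (d : nat)
    (F G : {mpoly k[n.+1]}),
    [/\ oset V x, local_coords y a, F \is d.-homog, G \is d.-homog
      & (exists b, peval a G * b = 1) /\ ores VU g * peval a G = peval a F].

Definition immersion (k : fieldType) (X : ringedSpace k) (L : omodule X)
    (n : nat) (y : 'I_n.+1 -> H0 L) : Prop :=
  exists phi : X -> proj_space k n,
    [/\ is_proj_map y phi,
        injective phi,
        forall U : set X, open U <-> exists2 W, open W & U = phi @^-1` W,
        locally_closed (range phi)
      & stalk_surjective y].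

Definition closed_immersion (k : fieldType) (X : ringedSpace k) (L : omodule X)
    (n : nat) (y : 'I_n.+1 -> H0 L) : Prop :=
  immersion y /\
  exists2 phi : X -> proj_space k n, is_proj_map y phi & closed (range phi).

Definition projective (k : fieldType) (X : scheme k) : Prop :=
  exists (M : line_bundle X) (n : nat) (y : 'I_n.+1 -> H0 M), closed_immersion y.

Definition very_ample (k : fieldType) (X : scheme k) (L : line_bundle X) : Prop :=
  exists (n : nat) (y : 'I_n.+1 -> H0 L), immersion y.

(* The degree d part I(X)_d of the homogeneous ideal of the image of X under
   (x_0 : ... : x_r). *)
Definition homog_ideal (k : fieldType) (X : ringedSpace k) (L : omodule X)
    (r : nat) (x : 'I_r.+1 -> H0 L) (d : nat) : set {mpoly k[r.+1]} :=
  [set F | F \is d.-homog /\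
     forall (U : opens X) (a : 'I_r.+1 -> O U), local_coords x a -> peval a F = 0].

Section Quadrics.
Variables (k : fieldType) (X : ringedSpace k) (L1 L2 M L : omodule X).
Variables (tau1 : omod_bilin L1 L1 M) (tau2 : omod_bilin M L2 L).
Variables (r : nat) (f : H0 L -> {mpoly k[r.+1]}).

Definition tens (s t : H0 L1) (h : H0 L2) : H0 L :=
  tau2 (whole X) (tau1 (whole X) s t) h.

Definition Q (s t : H0 L1) (h : H0 L2) : {mpoly k[r.+1]} :=
  f (tens s s h) * f (tens t t h) - f (tens s t h) ^+ 2.

Definition W : set {mpoly k[r.+1]} :=
  lin_span [set F | exists s t h, F = Q s t h].

Variables (p q : nat) (s : 'I_p -> H0 L1) (h : 'I_q -> H0 L2).

Definition Delta1 (i j : 'I_p) : bool := (i < j)%N.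
Definition Delta2 (i j l : 'I_p) : bool := [&& Delta1 i j, l != i & l != j].
Definition Delta3 (i j l m : 'I_p) : bool :=
  [&& Delta1 i j, Delta1 l m, (i < l)%N, j != l & j != m].

Definition Hset : set (H0 L2) :=
  [set g | (exists i, g = h i) \/
           (exists i j : 'I_q, (i < j)%N /\ g = h i + h j)].

Definition Gamma11 : set {mpoly k[r.+1]} :=
  [set F | exists i j g, [/\ Delta1 i j, Hset g & F = Q (s i) (s j) g]].

Definition Gamma12 : set {mpoly k[r.+1]} :=
  [set F | exists i j l g,
     [/\ Delta2 i j l, Hset g & F = Q (s i + s j) (s l) g]].

Definition Gamma22 : set {mpoly k[r.+1]} :=
  [set F | exists i j l m g,
     [/\ Delta3 i j l m, Hset g & F = Q (s i + s j) (s l + s m) g]].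

Definition Gamma : set {mpoly k[r.+1]} := Gamma11 `|` Gamma12 `|` Gamma22.

End Quadrics.

(* Main.v *)
Require Import Defs.
From HB Require Import structures.
From mathcomp Require Import all_boot all_order all_algebra.
From mathcomp Require Import boolp classical_sets topology_structure.
From mathcomp Require Import mpoly ssrcomplements ring.

Import GRing.Theory.
Local Open Scope classical_set_scope.
Local Open Scope ring_scope.

(** For fixed h, put B s t := f (s (x) t (x) h).  Then Q(s, t, h) is the Gram
    determinant B s s * B t t - (B s t)^2.

    The quadrics vanish on X because Q is locally the 2 x 2 determinant of a
    matrix of rank one.  Where L1 and L2 have frames e1 and e2, write
    s = a e1, t = b e1, h = c e2, and let w be the coordinate of
    e1 (x) e1 (x) e2 in a frame of L.  The linear form f (s (x) t (x) h) takes
    the value abcw, so that Q takes the value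
    (aacw)(bbcw) - (abcw)^2 = 0; and a function that vanishes locally is zero.
    This is [peval_Q].  The same trivialization shows that s (x) t is symmetric
    in s and t ([line_bundle_bilC]).

    The spanning statement rests on polarization: the value of a quadratic map
    at a combination of the vectors u_i is a combination of its values at the
    u_i and at the u_i + u_j with i < j ([quadratic_mem_span]).  The quadric
    Q(s, t, h) is quadratic in each of s, t and h, so three polarizations reduce
    it to arguments that are basis vectors or sums of two basis vectors.  This
    leaves, besides the members of Gamma, the index patterns with a
    coincidence.  A Gram determinant depends only on the bivector s /\ t, which
    disposes of them; the one that takes an actual identity is
    Q(u + v, u + w), treated in [gram_overlap]. *)

(** * Linear spans *)

Section LinSpan.
Variables (k : fieldType) (V : lmodType k) (A : set V).

Lemma lin_span_gen v : A v -> lin_span A v.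
Proof.
by move=> Av; exists 1%N, (fun=> 1), (fun=> v); rewrite big_ord1 scale1r.
Qed.

Lemma lin_span0 : lin_span A 0.
Proof. by exists 0%N, (fun=> 0), (fun=> 0); rewrite big_ord0; split=> // -[]. Qed.

Lemma lin_spanD u v : lin_span A u -> lin_span A v -> lin_span A (u + v).
Proof.
move=> [m [c [w [Aw ->]]]] [n [d [z [Az ->]]]].
pose glue T (a : 'I_m -> T) (b : 'I_n -> T) (i : 'I_(m + n)) :=
  match split i with inl j => a j | inr j => b j end.
exists (m + n)%N, (glue k c d), (glue V w z); split=> [i|].
  by rewrite /glue; case: (split i).
have splitl (i : 'I_m) : split (lshift n i) = inl i := unsplitK (inl i).
have splitr (i : 'I_n) : split (rshift m i) = inr i := unsplitK (inr i).
rewrite big_split_ord /=; congr (_ + _); apply: eq_bigr => i _.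
  by rewrite /glue splitl.
by rewrite /glue splitr.
Qed.

Lemma lin_spanZ a v : lin_span A v -> lin_span A (a *: v).
Proof.
move=> [n [c [w [Aw ->]]]]; exists n, (fun i => a * c i), w; split=> //.
by rewrite scaler_sumr; apply: eq_bigr => i _; rewrite scalerA.
Qed.

Lemma lin_spanB u v : lin_span A u -> lin_span A v -> lin_span A (u - v).
Proof. by move=> Au Av; rewrite -scaleN1r; apply/lin_spanD/lin_spanZ. Qed.

Lemma lin_span_sum (I : Type) (r : seq I) (P : pred I) (w : I -> V) :
  (forall i, P i -> lin_span A (w i)) -> lin_span A (\sum_(i <- r | P i) w i).
Proof. by move=> Aw; apply: big_ind => //; [apply: lin_span0|apply: lin_spanD]. Qed.

End LinSpan.

Lemma lin_span_min {k : fieldType} {V : lmodType k} (A B : set V) :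
  A `<=` lin_span B -> lin_span A `<=` lin_span B.
Proof.
move=> AB _ [n [c [w [Aw ->]]]]; apply: lin_span_sum => i _.
exact/lin_spanZ/AB.
Qed.

(** * Values of quadratic maps *)

Lemma linear_lincomb {k : fieldType} {U V : lmodType k} {g : U -> V} n
    (c : 'I_n -> k) (u : 'I_n -> U) :
  linear g -> g (\sum_i c i *: u i) = \sum_i c i *: g (u i).
Proof.
move=> g_lin.
pose G : {linear U -> V} := HB.pack g (GRing.isLinear.Build k U V *:%R g g_lin).
by rewrite -[g]/(G : U -> V) linear_sum; apply: eq_bigr => i _; rewrite linearZ.
Qed.

Section Quadratic.
Variables (k : fieldType) (U V : lmodType k) (b : U -> U -> V) (A : set V).
Hypothesis b_linl : forall u, linear (b^~ u).
Hypothesis b_linr : forall u, linear (b u).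

(** A double sum is made of its diagonal terms and of the sums of two mirror
    terms; so the form b below need not be symmetric. *)
Lemma lin_span_symm_sum n (T : 'I_n -> 'I_n -> V) :
  (forall i, lin_span A (T i i)) ->
  (forall i j : 'I_n, (i < j)%N -> lin_span A (T i j + T j i)) ->
  lin_span A (\sum_i \sum_j T i j).
Proof.
elim: n T => [|n IHn] T Td Ts; first by rewrite big_ord0; apply: lin_span0.
rewrite big_ord_recr /=.
under eq_bigr do rewrite big_ord_recr /=.
rewrite big_split big_ord_recr /= addrA -(addrA (\sum_i _)) -big_split /=.
apply: lin_spanD (Td _); apply: lin_spanD.
  by apply: IHn => [i|i j ij]; [apply: Td|apply: Ts].
by apply: lin_span_sum => i _; apply: Ts => /=.
Qed.

(** Polarization: b x y + b y x = b (x + y) (x + y) - b x x - b y y.  No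
    division by 2 occurs, since only such symmetrized terms appear. *)
Lemma quadratic_mem_span n (u : 'I_n -> U) (c : 'I_n -> k) :
  (forall i, lin_span A (b (u i) (u i))) ->
  (forall i j : 'I_n, (i < j)%N -> lin_span A (b (u i + u j) (u i + u j))) ->
  let v := \sum_i c i *: u i in lin_span A (b v v).
Proof.
move=> bd bs v.
have -> : b v v = \sum_i \sum_j (c i * c j) *: b (u i) (u j).
  rewrite (linear_lincomb _ _ _ (b_linl v)); apply: eq_bigr => i _.
  rewrite (linear_lincomb _ _ _ (b_linr (u i))) scaler_sumr.
  by apply: eq_bigr => j _; rewrite scalerA.
apply: lin_span_symm_sum => [i|i j ij]; first exact/lin_spanZ/bd.
rewrite [c j * _]mulrC -scalerDr; apply: lin_spanZ.
have bDl x y z : b (x + y) z = b x z + b y z.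
  by have := b_linl z 1 x y; rewrite !scale1r.
have bDr x y z : b z (x + y) = b z x + b z y.
  by have := b_linr z 1 x y; rewrite !scale1r.
have -> : b (u i) (u j) + b (u j) (u i)
  = b (u i + u j) (u i + u j) - b (u i) (u i) - b (u j) (u j).
  rewrite !(bDl, bDr) [b (u i) (u i) + _]addrC addrACA.
  by rewrite -[RHS]addrA -opprD addrK.
by apply: lin_spanB (bd j); apply: lin_spanB (bd i); apply: bs.
Qed.

End Quadratic.

(** * Gram determinants of a symmetric form *)

Section Gram.
Variables (k : fieldType) (V : lmodType k) (R : comAlgType k).
Variable B : V -> V -> R.
Hypothesis B_lin : forall u, linear (B u).
Hypothesis B_sym : forall u v, B u v = B v u.

Definition gram u v : R := B u u * B v v - B u v ^+ 2.

Lemma gramC u v : gram u v = gram v u.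
Proof. by rewrite /gram mulrC B_sym. Qed.

Lemma gramuu u : gram u u = 0.
Proof. by rewrite /gram -expr2 subrr. Qed.

Let BDr u v w : B u (v + w) = B u v + B u w.
Proof. by have := B_lin u 1 v w; rewrite !scale1r. Qed.

Let BDl u v w : B (v + w) u = B v u + B w u.
Proof. by rewrite B_sym BDr !(B_sym u). Qed.

Lemma gramDl u v : gram (u + v) u = gram v u.
Proof. by rewrite /gram !(BDl, BDr) (B_sym u v); ring. Qed.

(** Put a = u /\ v, b = u /\ w, c = v /\ w, and let q be the quadratic form on
    bivectors for which gram x y = q (x /\ y).  Then
    (u + v) /\ (u + w) = b - a + c, while the last three Gram determinants are
    q (a + b), q (b + c) and q (a - c).  The identity expresses q at a
    combination of three vectors through its values at the three vectors and at
    three pairwise sums or differences. *)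
Lemma gram_overlap u v w :
  gram (u + v) (u + w) =
    gram u v + gram u w - gram v w
    - gram (v + w) u + gram (u + v) w + gram (u + w) v.
Proof.
by rewrite /gram !(BDl, BDr) (B_sym v u) (B_sym w u) (B_sym w v); ring.
Qed.

(** The polarized form of gram(-, v) is the mixed minor
    B x y * B v v - B x v * B y v. *)
Lemma gram_quadratic_mem_span (A : set R) n (u : 'I_n -> V) (c : 'I_n -> k) v :
  (forall i, lin_span A (gram (u i) v)) ->
  (forall i j : 'I_n, (i < j)%N -> lin_span A (gram (u i + u j) v)) ->
  lin_span A (gram (\sum_i c i *: u i) v).
Proof.
pose b x y := B x y * B v v - B x v * B y v.
have bE x : b x x = gram x v by rewrite /b /gram expr2.
have b_sym x y : b x y = b y x by rewrite /b B_sym [B x v * _]mulrC.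
have b_linr x : linear (b x).
  move=> a y z; rewrite /b B_lin.
  have -> : B (a *: y + z) v = a *: B y v + B z v by rewrite !(B_sym _ v) B_lin.
  by rewrite mulrDl mulrDr -scalerAl -scalerAr opprD addrACA -scalerBr.
have b_linl x : linear (b^~ x).
  by move=> a y z; rewrite /= !(b_sym _ x) b_linr.
move=> Au As; rewrite -bE.
by apply: (quadratic_mem_span _ _ _ b _ b_linl b_linr) => [i|i j ij]; rewrite bE; [apply: Au|apply: As].
Qed.

(** Polarizing in both arguments leaves Gram determinants of basis vectors and
    of sums of two basis vectors with arbitrary indices.  The hypotheses cover
    only indices that are distinct and normalized by order; symmetry, the
    invariance gram (u + v) u = gram v u and [gram_overlap] give the others. *)
Lemma gram_mem_span (A : set R) p (s : 'I_p -> V) (a b : 'I_p -> k) :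
  (forall i j, Delta1 i j -> lin_span A (gram (s i) (s j))) ->
  (forall i j l, Delta2 i j l -> lin_span A (gram (s i + s j) (s l))) ->
  (forall i j l m, Delta3 i j l m ->
     lin_span A (gram (s i + s j) (s l + s m))) ->
  lin_span A (gram (\sum_i a i *: s i) (\sum_i b i *: s i)).
Proof.
move=> A11 A12 A22.
have S11 i j : lin_span A (gram (s i) (s j)).
  case: (ltngtP i j) => [ij|ji|/val_inj ->]; first exact: A11.
    by rewrite gramC; apply: A11.
  by rewrite gramuu; apply: lin_span0.
have S12 (i j l : 'I_p) : (i != j)%N -> lin_span A (gram (s i + s j) (s l)).
  wlog ij : i j / (i < j)%N.
    move=> H; case: (ltngtP i j) => [ij|ji|/val_inj ->]; last by rewrite eqxx.
      exact: H.
    by rewrite addrC eq_sym; apply: H.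
  move=> _; have [->|li] := eqVneq l i; first by rewrite gramDl.
  have [->|lj] := eqVneq l j; first by rewrite addrC gramDl.
  by apply: A12; rewrite /Delta2 /Delta1 ij li.
have overlap (i j m : 'I_p) : i != j -> i != m ->
    lin_span A (gram (s i + s j) (s i + s m)).
  move=> ij im; have [->|jm] := eqVneq j m; first by rewrite gramuu; apply: lin_span0.
  rewrite gram_overlap.
  apply: lin_spanD (S12 _ _ _ im); apply: lin_spanD (S12 _ _ _ ij).
  apply: lin_spanB (S12 _ _ _ jm); apply: lin_spanB (S11 _ _).
  exact: lin_spanD (S11 _ _) (S11 _ _).
have S22 (i j l m : 'I_p) : (i < j)%N -> (l < m)%N ->
    lin_span A (gram (s i + s j) (s l + s m)).
  move=> ij lm.
  have nij : i != j by rewrite -val_eqE ltn_eqF.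
  have nlm : l != m by rewrite -val_eqE ltn_eqF.
  have [eil|nil] := eqVneq i l; first by rewrite -eil; apply: overlap => //; rewrite eil.
  have [eim|nim] := eqVneq i m.
    by rewrite -eim (addrC (s l)); apply: overlap => //; rewrite eim eq_sym.
  have [ejl|njl] := eqVneq j l.
    by rewrite -ejl (addrC (s i)); apply: overlap; rewrite 1?eq_sym // ejl eq_sym.
  have [ejm|njm] := eqVneq j m.
    rewrite -ejm (addrC (s i)) (addrC (s l)).
    by apply: overlap; rewrite eq_sym // ejm.
  case: (ltngtP i l) => [il|li|/val_inj eil]; last by rewrite eil eqxx in nil.
    by apply: A22; rewrite /Delta3 /Delta1 ij lm il njl.
  by rewrite gramC; apply: A22; rewrite /Delta3 /Delta1 ij lm li 1?eq_sym nim eq_sym njm.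
apply: gram_quadratic_mem_span => [i|i j ij]; rewrite gramC;
  apply: gram_quadratic_mem_span => [l|l m lm].
- exact: S11.
- by apply: S12; rewrite -val_eqE ltn_eqF.
- by rewrite gramC; apply: S12; rewrite -val_eqE ltn_eqF.
- exact: S22.
Qed.

End Gram.

(** * Sections of sheaves *)

Definition opensI {T : topologicalType} (U V : opens T) : opens T :=
  let: Opens A oA := U in let: Opens B oB := V in Opens (openI oA oB).

Lemma opensIE {T : topologicalType} (U V : opens T) : opensI U V = U `&` V :> set T.
Proof. by case: U; case: V. Qed.

(** The separation axiom: both s and t glue the family of restrictions of s to
    the open sets on which s and t agree. *)
Lemma sheaf_eq (T : topologicalType) (F : opens T -> Type)
    (res : forall U V : opens T, V `<=` U -> F U -> F V) (U : opens T)
    (s t : F U) :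
  is_sheaf res ->
  (forall x, oset U x -> exists (V : opens T) (VU : V `<=` U),
      oset V x /\ res U V VU s = res U V VU t) ->
  s = t.
Proof.
move=> [_ resT glue] st.
pose I := {V : opens T | exists VU : V `<=` U, res U V VU s = res U V VU t}.
have IU (i : I) : sval i `<=` U by case: i => V [].
have cover x : oset U x -> exists i : I, oset (sval i) x.
  by move=> /st[V [VU [Vx e]]]; exists (exist _ V (ex_intro _ VU e)).
have compat (i j : I) (W : opens T) (Wi : W `<=` sval i) (Wj : W `<=` sval j) :
    res _ W Wi (res U _ (IU i) s) = res _ W Wj (res U _ (IU j) s).
  by rewrite !(resT _ _ _ _ _ (subset_trans Wi (IU i))).
have [u [_ uniq_u]] :=
  glue I U (fun i => sval i) IU cover (fun i => res U _ (IU i) s) compat.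
rewrite -(uniq_u s) // -(uniq_u t) // => i.
by case: i (IU i) => V [VU e] /= IV; rewrite (Prop_irrelevance IV VU).
Qed.

Section Sections.
Variables (k : fieldType) (X : ringedSpace k).
Implicit Types (U V W : opens X) (F G N : omodule X).

Lemma mresT F U V W (VU : V `<=` U) (WV : W `<=` V) (WU : W `<=` U) (s : F U) :
  mres WV (mres VU s) = mres WU s.
Proof. by have [_ + _] := mres_sheaf F; apply. Qed.

Lemma oresT U V W (VU : V `<=` U) (WV : W `<=` V) (WU : W `<=` U) (a : O U) :
  ores WV (ores VU a) = ores WU a.
Proof. by have [_ + _] := ores_sheaf X; apply. Qed.

Lemma mres_id F U (UU : U `<=` U) (s : F U) : mres UU s = s.
Proof. by have [+ _ _] := mres_sheaf F; apply. Qed.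

Lemma mresD F U V (VU : V `<=` U) (s t : F U) :
  mres VU (s + t) = mres VU s + mres VU t.
Proof. by have := mres_lin VU 1 s t; rewrite rmorph1 !scale1r. Qed.

Lemma mres0 F U V (VU : V `<=` U) : mres VU (0 : F U) = 0.
Proof. by apply: (@addrI _ (mres VU 0)); rewrite -mresD !addr0. Qed.

Lemma mresZ F U V (VU : V `<=` U) a (s : F U) :
  mres VU (a *: s) = ores VU a *: mres VU s.
Proof. by have := mres_lin VU a s 0; rewrite mres0 !addr0. Qed.

Lemma bil0l F G N (tau : omod_bilin F G N) U (t : G U) : tau U 0 t = 0.
Proof.
by apply: (@addrI _ (tau U 0 t)); have := bil_linl tau 1 0 0 t;
  rewrite !scale1r !addr0 => <-.
Qed.

Lemma bil0r F G N (tau : omod_bilin F G N) U (s : F U) : tau U s 0 = 0.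
Proof.
by apply: (@addrI _ (tau U s 0)); have := bil_linr tau 1 s 0 0;
  rewrite !scale1r !addr0 => <-.
Qed.

Lemma bilZl F G N (tau : omod_bilin F G N) U a (s : F U) (t : G U) :
  tau U (a *: s) t = a *: tau U s t.
Proof. by have := bil_linl tau a s 0 t; rewrite bil0l !addr0. Qed.

Lemma bilZr F G N (tau : omod_bilin F G N) U a (s : F U) (t : G U) :
  tau U s (a *: t) = a *: tau U s t.
Proof. by have := bil_linr tau a s t 0; rewrite bil0r !addr0. Qed.

Lemma is_frame_res F U V (VU : V `<=` U) (e : F U) :
  is_frame e -> is_frame (mres VU e).
Proof.
move=> fe W WV; rewrite (mresT _ _ _ _ _ _ (subset_trans WV VU)); exact: fe.
Qed.

Lemma frame_inj F U (e : F U) : is_frame e -> injective (fun a : O U => a *: e).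
Proof.
move=> fe a b ab; apply: (bij_inj (fe U (fun=> id))).
by rewrite mres_id.
Qed.

Lemma frame_coord F U (e : F U) (s : F U) : is_frame e -> exists a, s = a *: e.
Proof.
move=> fe; have [c _ cK] := fe U (fun=> id).
by exists (c s); rewrite -[LHS]cK mres_id.
Qed.

Lemma frame_near (L : line_bundle X) U (x : X) : oset U x ->
  exists (V : opens X) (VU : V `<=` U), oset V x /\ exists e : L V, is_frame e.
Proof.
move=> Ux; have [V Vx [e fe]] := locally_trivial L x.
have IU : opensI U V `<=` U by rewrite opensIE => y [].
have IV : opensI U V `<=` V by rewrite opensIE => y [].
exists (opensI U V), IU; split; first by rewrite opensIE.
by exists (mres IV e); apply: is_frame_res.
Qed.

(** A bilinear map on a module that is locally free of rank one is symmetric: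
    (a e, b e) and (b e, a e) both go to ab times the image of (e, e). *)
Lemma line_bundle_bilC (L : line_bundle X) N (tau : omod_bilin L L N) U
    (s t : L U) : tau U s t = tau U t s.
Proof.
apply: (sheaf_eq _ _ _ _ _ _ (mres_sheaf N)) => x Ux.
have [V [VU [Vx [e fe]]]] := frame_near L U x Ux.
exists V, VU; split=> //; rewrite !bil_nat.
have [a ->] := frame_coord _ _ _ (mres VU s) fe.
have [b ->] := frame_coord _ _ _ (mres VU t) fe.
by rewrite !bilZl !bilZr !scalerA mulrC.
Qed.

(** * Evaluation of forms at local coordinates *)

Section Peval.
Variables (U : opens X) (n : nat) (a : 'I_n -> O U).

Let mon (m : 'X_{1..n}) : O U := \prod_(i < n) a i ^+ m i.

Lemma kres0 : kres U 0 = 0.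
Proof. by rewrite /kres !rmorph0. Qed.

(** Summing over all monomials of bounded degree makes the index set common to
    several polynomials, which is what additivity needs. *)
Lemma peval_bound d (F : {mpoly k[n]}) : (msize F <= d)%N ->
  peval a F = \sum_(m : 'X_{1..n < d}) kres U F@_m * mon m.
Proof.
move=> Fd; pose I : subFinType _ := 'X_{1..n < d}.
rewrite /peval (big_mksub I) /=; first last.
- by move=> m /msize_mdeg_lt /leq_trans; apply.
- exact: msupp_uniq.
rewrite big_rmcond //= => m /memN_msupp_eq0 ->.
by rewrite kres0 mul0r.
Qed.

Lemma pevalP c (F G : {mpoly k[n]}) :
  peval a (c *: F + G) = kres U c * peval a F + peval a G.
Proof.
pose d := maxn (msize (c *: F + G)) (maxn (msize F) (msize G)).
rewrite !(@peval_bound d) ?leq_max ?leqnn ?orbT //.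
rewrite mulr_sumr -big_split /=; apply: eq_bigr => m _.
by rewrite mcoeffD mcoeffZ /kres !rmorphD !rmorphM mulrDl mulrA.
Qed.

Lemma peval0 : peval a 0 = 0.
Proof. by rewrite /peval msupp0 big_nil. Qed.

Lemma pevalD (F G : {mpoly k[n]}) : peval a (F + G) = peval a F + peval a G.
Proof. by have := pevalP 1 F G; rewrite scale1r /kres !rmorph1 mul1r. Qed.

Lemma pevalZ c (F : {mpoly k[n]}) : peval a (c *: F) = kres U c * peval a F.
Proof. by have := pevalP c F 0; rewrite peval0 !addr0. Qed.

Lemma peval_sum (I : Type) (r : seq I) (P : pred I) (F : I -> {mpoly k[n]}) :
  peval a (\sum_(i <- r | P i) F i) = \sum_(i <- r | P i) peval a (F i).
Proof. exact: (big_morph _ pevalD peval0). Qed.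

Lemma peval_mon m : peval a 'X_[m] = mon m.
Proof. by rewrite /peval msuppX big_seq1 mcoeffX eqxx /kres !rmorph1 mul1r. Qed.

Lemma pevalX i : peval a 'X_i = a i.
Proof.
rewrite peval_mon /mon (bigD1 i) //= mnm1E eqxx expr1 big1 ?mulr1 // => j ji.
by rewrite mnm1E eq_sym (negPf ji) expr0.
Qed.

Lemma pevalM (F G : {mpoly k[n]}) : peval a (F * G) = peval a F * peval a G.
Proof.
rewrite [F]mpolyE [G]mpolyE mulr_suml !peval_sum mulr_suml.
apply: eq_bigr => m _; rewrite mulr_sumr peval_sum mulr_sumr.
apply: eq_bigr => m' _.
rewrite -scalerAl -scalerAr -mpolyXD !pevalZ !peval_mon.
have -> : mon (m + m')%MM = mon m * mon m'.
  by rewrite -big_split; apply: eq_bigr => i _; rewrite mnmDE exprD.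
by rewrite !mulrA; congr (_ * _); rewrite -!mulrA; congr (_ * _); rewrite mulrC.
Qed.

End Peval.

(** * Linear forms and the sections they cut out *)

Section Coordinates.
Variables (L : omodule X) (r : nat) (x : 'I_r.+1 -> H0 L).
Variable f : {linear H0 L -> {mpoly k[r.+1]}}.
Hypothesis x_basis : is_basis x.
Hypothesis f_coord : forall i, f (x i) = 'X_i.

Lemma coord_homog v : f v \is 1.-homog.
Proof.
have [c [-> _]] := x_basis v; rewrite linear_sum rpred_sum // => i _.
by rewrite linearZ rpredZ //= f_coord dhomogX; apply/eqP/mdeg1.
Qed.

(** The linear form attached to a section v takes, at local coordinates, the
    value of v in the frame: this is what ties the forms f v to the geometry of
    X. *)
Lemma peval_coord (U : opens X) (a : 'I_r.+1 -> O U) (e : L U) v :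
  (forall i, restrict U (x i) = a i *: e) ->
  peval a (f v) *: e = restrict U v.
Proof.
move=> xe; have [c [-> _]] := x_basis v.
rewrite linear_sum peval_sum scaler_suml /restrict.
rewrite (big_morph _ (mresD L _ _ _) (mres0 L _ _ _)); apply: eq_bigr => i _.
rewrite linearZ /= pevalZ f_coord pevalX -scalerA -xe.
by rewrite /restrict /kres -mresZ.
Qed.

End Coordinates.

(** * The quadrics vanish on X *)

Section Quadrics.
Variables (L1 L2 : line_bundle X) (M L : omodule X).
Variables (tau1 : omod_bilin L1 L1 M) (tau2 : omod_bilin M L2 L).

Lemma tens_frameE U (e1 : L1 U) (e2 : L2 U) (a b c : O U) :
  tau2 U (tau1 U (a *: e1) (b *: e1)) (c *: e2)
    = (a * b * c) *: tau2 U (tau1 U e1 e1) e2.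
Proof. by rewrite !(bilZl, bilZr) !scalerA; congr (_ *: _); ring. Qed.

Lemma restrict_tens U (s t : H0 L1) (h : H0 L2) :
  restrict U (tens tau1 tau2 s t h)
    = tau2 U (tau1 U (restrict U s) (restrict U t)) (restrict U h).
Proof. by rewrite /restrict /tens !bil_nat. Qed.

Variables (r : nat) (x : 'I_r.+1 -> H0 L).
Variable f : {linear H0 L -> {mpoly k[r.+1]}}.
Hypothesis x_basis : is_basis x.
Hypothesis f_coord : forall i, f (x i) = 'X_i.

(** Locally the three linear forms in Q take the values aacw, bbcw and abcw. *)
Lemma peval_Q U (a : 'I_r.+1 -> O U) s t h :
  local_coords x a -> peval a (Q tau1 tau2 f s t h) = 0.
Proof.
move=> [e fe xe].
rewrite /Q -scaleN1r addrC pevalP expr2 !pevalM.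
rewrite /kres rmorphN1 rmorphN1 mulN1r addrC; apply/eqP; rewrite subr_eq0; apply/eqP.
apply: (sheaf_eq _ _ _ _ _ _ (ores_sheaf X)) => y Uy.
(* On V all three of L1, L2 and L have a frame. *)
have [V1 [V1U [V1y [e1 fe1]]]] := frame_near L1 U y Uy.
have [V [VV1 [Vy [e2 fe2]]]] := frame_near L2 V1 y V1y.
have VU := subset_trans VV1 V1U.
exists V, VU; split=> //; rewrite !rmorphM.
have {}fe1 := is_frame_res _ _ _ VV1 _ fe1.
have fe' := is_frame_res _ _ _ VU _ fe.
set e1' := mres VV1 e1 in fe1; set e' := mres VU e in fe'.
have [w we] := frame_coord _ _ _ (tau2 V (tau1 V e1' e1') e2) fe'.
have [as_ se] := frame_coord _ _ _ (restrict V s) fe1.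
have [at_ te] := frame_coord _ _ _ (restrict V t) fe1.
have [c he] := frame_coord _ _ _ (restrict V h) fe2.
have coordE (u v : H0 L1) (b d : O V) : restrict V u = b *: e1' ->
    restrict V v = d *: e1' ->
    ores VU (peval a (f (tens tau1 tau2 u v h))) = b * d * c * w.
  move=> ue ve; apply: (frame_inj _ _ _ fe').
  rewrite -mresZ (peval_coord _ _ _ _ x_basis f_coord _ _ _ _ xe).
  rewrite /restrict (mresT _ _ _ _ _ _ (@sub_whole _ V)) -/(restrict V _).
  by rewrite restrict_tens ue ve he tens_frameE we scalerA.
rewrite (coordE s s _ _ se se) (coordE t t _ _ te te) (coordE s t _ _ se te).
ring.
Qed.

Lemma Q_homog s t h : Q tau1 tau2 f s t h \is 2.-homog.
Proof.
have fh := coord_homog _ _ _ _ x_basis f_coord.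
by rewrite /Q expr2 rpredB // -[2%N]/(1 + 1)%N dhomogM.
Qed.

Lemma W_sub_homog_ideal : W tau1 tau2 f `<=` homog_ideal x 2.
Proof.
move=> _ [n [c [w [Qw ->]]]]; split=> [|U a xa].
  by rewrite rpred_sum // => i _; have [s [t [h ->]]] := Qw i; rewrite rpredZ // Q_homog.
rewrite peval_sum big1 // => i _; have [s [t [h ->]]] := Qw i.
by rewrite pevalZ peval_Q // mulr0.
Qed.

(** * Spanning by the quadrics in Gamma *)

Let B (h : H0 L2) (s t : H0 L1) := f (tens tau1 tau2 s t h).

Lemma tens_linr h s : linear (fun t => f (tens tau1 tau2 s t h)).
Proof. by move=> a t t'; rewrite /tens bil_linr bil_linl linearP. Qed.

Lemma tens_linh s t : linear (fun h => f (tens tau1 tau2 s t h)).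
Proof. by move=> a h h'; rewrite /tens bil_linr linearP. Qed.

Lemma tensC h s t : tens tau1 tau2 s t h = tens tau1 tau2 t s h.
Proof. by rewrite /tens line_bundle_bilC. Qed.

(** Q is quadratic in h, and the values of a quadratic map at the members of
    Hset are exactly those that polarization needs. *)
Lemma Q_mem_span_Hset (A : set {mpoly k[r.+1]}) q (h : 'I_q -> H0 L2)
    (c : 'I_q -> k) s t :
  (forall g, Hset h g -> lin_span A (Q tau1 tau2 f s t g)) ->
  lin_span A (Q tau1 tau2 f s t (\sum_i c i *: h i)).
Proof.
move=> AH.
pose b g g' := B g s s * B g' t t - B g s t * B g' s t.
have bE g : b g g = Q tau1 tau2 f s t g by rewrite /b /Q expr2.
have b_linr g : linear (b g).
  move=> a u v; rewrite /b /B !tens_linh !mulrDr -!scalerAr.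
  by rewrite opprD addrACA -scalerBr.
have b_linl g : linear (b^~ g).
  move=> a u v; rewrite /b /B !tens_linh !mulrDl -!scalerAl.
  by rewrite opprD addrACA -scalerBr.
rewrite -bE; apply: (quadratic_mem_span _ _ _ b _ b_linl b_linr) => [i|i j ij].
  by rewrite bE; apply: AH; left; exists i.
by rewrite bE; apply: AH; right; exists i, j.
Qed.

Lemma W_eq_span_Gamma p q (s : 'I_p -> H0 L1) (h : 'I_q -> H0 L2) :
  is_basis s -> is_basis h ->
  W tau1 tau2 f = lin_span (Gamma tau1 tau2 f s h).
Proof.
move=> s_basis h_basis; apply/seteqP; split; apply: lin_span_min => F.
  move=> [u [v [g ->]]].
  have [a [-> _]] := s_basis u; have [b [-> _]] := s_basis v.
  have [c [-> _]] := h_basis g.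
  apply: Q_mem_span_Hset => {}g Hg.
  have Bg_lin := tens_linr g.
  have Bg_sym u1 u2 : B g u1 u2 = B g u2 u1 by rewrite /B tensC.
  apply: (gram_mem_span _ _ _ (B g) Bg_lin Bg_sym) => [i j D|i j l D|i j l m D];
    apply: lin_span_gen.
  - by left; left; exists i, j, g.
  - by left; right; exists i, j, l, g.
  - by right; exists i, j, l, m, g.
have QW u v g : W tau1 tau2 f (Q tau1 tau2 f u v g).
  by apply: lin_span_gen; exists u, v, g.
by case=> [[[i [j [g [_ _ ->]]]]|[i [j [l [g [_ _ ->]]]]]]
  |[i [j [l [m [g [_ _ ->]]]]]]]; apply: QW.
Qed.

End Quadrics.

End Sections.

Theorem theorem2p2 (k : closedFieldType) (char_k : 2%N \notin [pchar k])
  (X : scheme k) (X_proj : projective X)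
  (L L1 L2 : line_bundle X) (L_va : very_ample L)
  (* L = L1 (x) L1 (x) L2, with M = L1 (x) L1 *)
  (M : omodule X) (tau1 : omod_bilin L1 L1 M) (tau2 : omod_bilin M L2 L)
  (tau1_tensor : is_tensor tau1) (tau2_tensor : is_tensor tau2)
  (p q : nat) (p_ge2 : (2 <= p)%N) (q_ge1 : (1 <= q)%N)
  (s : 'I_p -> H0 L1) (s_basis : is_basis s)
  (h : 'I_q -> H0 L2) (h_basis : is_basis h)
  (* homogeneous coordinates on P^r = P H^0(X, L) *)
  (r : nat) (x : 'I_r.+1 -> H0 L) (x_basis : is_basis x)
  (f : {linear H0 L -> {mpoly k[r.+1]}}) (f_coord : forall i, f (x i) = 'X_i) :
  W tau1 tau2 f `<=` homog_ideal x 2 /\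
  W tau1 tau2 f = lin_span (Gamma tau1 tau2 f s h).
Proof.
split; first exact: W_sub_homog_ideal.
exact: W_eq_span_Gamma.
Qed.
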